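(* For every integer $n\ge 2$, the Bubble Sort graph $BSG(n)$ satisfies $BSG(n)\to H_{\binom{n}{2}}$; that is, $BSG(n)$ is isomorphic to an isometric subgraph of the $\binom{n}{2}$-dimensional hypercube graph.
   Context: For a finite group $\Gamma$ and a generating set $S$ with $S=S^{-1}$ and $id\notin S$, the Cayley graph has vertex set $\Gamma$ and edges the pairs $(g,gs)$ with $g\in \Gamma$, $s\in S$. The Bubble Sort graph $BSG(n)$ is the Cayley graph of the symmetric group $Sym(n)$ with generating set $S=\{(1,2),(2,3),\dots,(n-1,n)\}$ of adjacent transpositions. $H_m$ is the graph of the $m$-dimensional cube: its vertices are the binary sequences of length $m$, adjacent iff their Hamming distance $d_H$ is $1$. For a connected graph $G$ with shortest-path metric $d_G$, $G\to H_m$ means that there is a map $\phi$ from the vertices of $G$ to those of $H_m$ with $d_H(\phi(u),\phi(v))=d_G(u,v)$ for all vertices $u,v$ of $G$. *)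

(* Defs.v *)
From HB Require Import structures.
From mathcomp Require Import all_boot all_fingroup.

Set Implicit Arguments.
Unset Strict Implicit.
Unset Printing Implicit Defensive.

(* A graph with vertex set T is given by its adjacency relation e : rel T. *)

Section Graphs.
Variable T : finType.
Implicit Types (e f : rel T) (x y : T).

Definition connected e := forall x y, connect e x y.

Definition has_walk e x y k :=
  [exists p : k.-tuple T, path e x p && (last x p == y)].

(* Shortest-path distance; #|T|, larger than any actual distance, if there is
   no path from x to y. *)
Definition gdist e x y := find (has_walk e x y) (iota 0 #|T|).

Lemma has_walkP e x y k :
  reflect (exists p, [/\ path e x p, last x p = y & size p = k])
          (has_walk e x y k).
Proof.
apply: (iffP existsP) => [[p /andP[ep /eqP lp]] | [p [ep lp /eqP sp]]].
  by exists p; rewrite size_tuple.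
by exists (Tuple sp); rewrite /= ep lp eqxx.
Qed.

Lemma gdist_min e x y p : path e x p -> last x p = y -> gdist e x y <= size p.
Proof.
move=> ep lp; rewrite leqNgt; apply/negP => lt_p.
have lt_pT : size p < #|T|.
  by apply: leq_trans lt_p _; rewrite -[leqRHS](size_iota 0) find_size.
have := before_find 0 lt_p; rewrite nth_iota // add0n => nw.
suff: has_walk e x y (size p) by rewrite nw.
by apply/has_walkP; exists p.
Qed.

Lemma gdist_walk e x y : connect e x y ->
  exists p, [/\ path e x p, last x p = y & size p = gdist e x y].
Proof.
move=> /connectP[p0 /shortenP[p ep up _] lp].
have lt_p : size p < #|T| by rewrite -[(size p).+1]/(size (x :: p)) -(card_uniqP up) max_card.
have hasw : has (has_walk e x y) (iota 0 #|T|).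
  apply/hasP; exists (size p); first by rewrite mem_iota.
  by apply/has_walkP; exists p.
suff: has_walk e x y (gdist e x y) by move/has_walkP.
have := nth_find 0 hasw.
by rewrite nth_iota ?add0n // -[ltnRHS](size_iota 0) -has_find.
Qed.

(* (W, f) is a subgraph of (T, e) on which distances agree with those of e;
   f-paths issued from W stay in W, so gdist f is the distance of (W, f). *)
Definition isometric_subgraph e (W : {set T}) f :=
  [/\ symmetric f,
      forall x y, f x y -> [&& x \in W, y \in W & e x y]
    & {in W &, forall x y, connect f x y /\ gdist f x y = gdist e x y}].

End Graphs.

(* The graph e on T is isomorphic to the subgraph (W, f) of some graph on V. *)
Definition isomorphic_to (T V : finType) (e : rel T) (W : {set V}) (f : rel V) :=
  exists phi : T -> V,
    [/\ injective phi, phi @: [set: T] = W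
      & forall x y, f (phi x) (phi y) = e x y].

Definition hamming m (u v : m.-tuple bool) : nat :=
  #|[set i : 'I_m | tnth u i != tnth v i]|.

Definition hypercube m : rel (m.-tuple bool) := fun u v => hamming u v == 1.
Arguments hypercube m : clear implicits.

Definition cube_embeddable (T : finType) (e : rel T) (m : nat) :=
  connected e /\
  exists phi : T -> m.-tuple bool,
    forall u v, hamming (phi u) (phi v) = gdist e u v.

Definition cayley (gT : finGroupType) (S : {set gT}) : rel gT :=
  fun g h => [exists s in S, h == (g * s)%g].

Definition adjacent_transpositions n : {set 'S_n} :=
  [set s | [exists i : 'I_n, exists j : 'I_n,
              (val j == (val i).+1) && (s == tperm i j)]].

(* In 'S_n the product g * s is "first g, then s"; the opposite convention
   gives an isomorphic graph, through g |-> g^-1. *)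
Definition BSG n : rel 'S_n := cayley (adjacent_transpositions n).
Arguments BSG n : clear implicits.

Lemma adjacent_transpositionsP n (s : 'S_n) :
  reflect (exists i j : 'I_n, val j = (val i).+1 /\ s = tperm i j)
          (s \in adjacent_transpositions n).
Proof.
rewrite inE; apply: (iffP existsP) => [[i /existsP[j /andP[/eqP ? /eqP ?]]]|].
  by exists i, j.
by move=> [i [j [ji ->]]]; exists i; apply/existsP; exists j; rewrite ji !eqxx.
Qed.

Lemma adjacent_transpositions_inv n :
  ((adjacent_transpositions n)^-1)%g = adjacent_transpositions n.
Proof.
apply/setP => s; rewrite inE; apply/adjacent_transpositionsP/adjacent_transpositionsP.
  by move=> [i [j [ji si]]]; exists i, j; rewrite -[s]invgK si tpermV.
by move=> [i [j [ji ->]]]; exists i, j; rewrite tpermV.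
Qed.

Lemma adjacent_transpositions_id n : (1%g \in adjacent_transpositions n) = false.
Proof.
apply/adjacent_transpositionsP => -[i [j [ji e1]]].
have := tpermL i j; rewrite -e1 perm1 => ij.
by move: ji; rewrite -ij => /n_Sn.
Qed.

Lemma adjacent_transpositions_gen n :
  <<adjacent_transpositions n>>%g = [set: 'S_n].
Proof.
apply/eqP; rewrite eqEsubset subsetT /=; apply/subsetP => s _.
have tgen k (i j : 'I_n) : val j = (val i + k).+1 ->
    tperm i j \in <<adjacent_transpositions n>>%g.
  elim: k j => [|k IHk] j jE.
    apply: mem_gen; apply/adjacent_transpositionsP; exists i, j.
    by rewrite jE addn0.
  have ltl : (val i + k).+1 < n.
    by apply: ltn_trans (ltn_ord j); rewrite [ltnRHS]jE addnS ltnS.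
  pose l := Ordinal ltl.
  have lj : tperm l j \in <<adjacent_transpositions n>>%g.
    apply: mem_gen; apply/adjacent_transpositionsP; exists l, j.
    by rewrite jE /= addnS.
  have ltil : i < l by rewrite /= ltnS leq_addr.
  have ltij : i < j by rewrite [X in _ < X]jE ltnS leq_addr.
  have -> : tperm i j = (tperm i l ^ tperm l j)%g.
    by rewrite tpermJ tpermL tpermD // -val_eqE neq_ltn ?ltil ?ltij orbT.
  apply: groupJ => //; exact: IHk.
have [ts -> tsP] := prod_tpermP s.
rewrite big_seq; apply: group_prod => -[i j] /(allP tsP); rewrite /dpair /= => neq.
have [ltij|ltji|/val_inj eqij] := ltngtP (val i) (val j).
- by apply: (tgen (j - i.+1)); rewrite -addSn subnKC.
- by rewrite tpermC; apply: (tgen (i - j.+1)); rewrite -addSn subnKC.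
by rewrite eqij eqxx in neq.
Qed.

(* Main.v *)
Require Import Defs.
From mathcomp Require Import all_boot all_fingroup.
From mathcomp Require Import zify.

Set Implicit Arguments.
Unset Strict Implicit.
Unset Printing Implicit Defensive.

(** The cube has one coordinate for each pair of positions [a < b], and a
permutation [u] is sent to its inversion table: the coordinate [(a, b)] records
whether [u b < u a].  An edge of the Bubble Sort graph composes [u] with the
exchange of two consecutive values [i] and [i + 1]; no other value lies between
them, so the only order relation that changes is the one between the positions
where [u] takes these two values ([inverted_swap]).  Edges thus become edges
of the cube, and a walk is at least as long as the Hamming distance between its
ends.

Conversely, if [u <> v] then, on reading the values of [v] at the positions
where [u] takes the values 0, 1, 2, ..., a descent is met, because the identity
is the only permutation without descents ([exists_descent]).  Exchanging the two
consecutive values of [u] at that descent corrects a coordinate on which [u] and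
[v] disagree.  Repeating this gives a walk from [u] to [v] whose length is the
Hamming distance ([cube_embedding_by_descent]).

Such a distance preserving map is an isomorphism onto the subgraph of the cube
induced by its image.  Geodesics of the source stay in the image, and a walk in
the cube is never shorter than the Hamming distance; distances in the image
are thus the same as in the cube ([isometric_image]). *)

(** * Walks in the cube *)

Section Cube.
Variable m : nat.
Implicit Types u v w : m.-tuple bool.

Lemma hamming0 u v : (hamming u v == 0) = (u == v).
Proof.
rewrite cards_eq0; apply/eqP/eqP => [D0 | ->].
  apply: eq_from_tnth => i; apply/eqP/negPn.
  by have := in_set0 i; rewrite -D0 inE => ->.
by apply/setP => i; rewrite !inE eqxx.
Qed.

Lemma hammingC u v : hamming u v = hamming v u.
Proof. by apply: eq_card => i; rewrite !inE eq_sym. Qed.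

Lemma hamming_triangle u v w : hamming u w <= hamming u v + hamming v w.
Proof.
apply: leq_trans (leq_card_setU _ _); apply: subset_leq_card.
apply/subsetP => i; rewrite !inE.
by case: (tnth u i) (tnth v i) (tnth w i) => [] [] [].
Qed.

Lemma hamming_walk u p :
  path (hypercube m) u p -> hamming u (last u p) <= size p.
Proof.
elim: p u => [|v p IHp] u /=; first by rewrite leqn0 hamming0.
case/andP=> /eqP uv /IHp le_p.
by apply: leq_trans (hamming_triangle u v _) _; rewrite uv add1n ltnS.
Qed.

End Cube.

(** * Isometric embeddings of graphs in the cube *)

Lemma gdist_geodesic (T : finType) (e : rel T) x y p :
    path e x p -> last x p = y ->
    (forall q, path e x q -> last x q = y -> size p <= size q) ->
  gdist e x y = size p.
Proof.
move=> ep lp min_p; apply/eqP; rewrite eqn_leq (gdist_min ep lp) /=.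
have /gdist_walk[q [eq lq <-]] : connect e x y by apply/connectP; exists p.
exact: min_p.
Qed.

Lemma gdist1 (T : finType) (e : rel T) x y :
  irreflexive e -> connect e x y -> (gdist e x y == 1) = e x y.
Proof.
move=> e_irr /gdist_walk[p [ep lp sp]]; apply/eqP/idP => [d1 | exy].
  by move: ep lp sp; rewrite d1; case: p => [|z []] //= /andP[exz _] <-.
apply/eqP; rewrite eqn_leq (@gdist_min _ _ _ _ [:: y]) //= ?exy //.
rewrite -sp; case: p lp {ep sp} => //= xy.
by rewrite xy e_irr in exy.
Qed.

Section Embedding.
Variables (T : finType) (e : rel T) (m : nat) (phi : T -> m.-tuple bool).

(** Steps towards the target, taken until it is reached, form a walk of length
at most the Hamming distance; since edges are sent to edges of the cube, no walk
can be shorter. *)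
Lemma cube_embedding_by_descent :
    (forall x y, e x y -> hypercube m (phi x) (phi y)) ->
    (forall x y, x != y ->
       exists2 z, e x z & hamming (phi z) (phi y) < hamming (phi x) (phi y)) ->
  connected e /\ forall x y, hamming (phi x) (phi y) = gdist e x y.
Proof.
move=> phi_e descend.
have lower x p : path e x p -> hamming (phi x) (phi (last x p)) <= size p.
  move=> ep; rewrite -last_map -(size_map phi); apply: hamming_walk.
  by rewrite path_map; apply: sub_path ep.
have upper x y : exists p,
    [/\ path e x p, last x p = y & size p <= hamming (phi x) (phi y)].
  have [k] := ubnP (hamming (phi x) (phi y)); elim: k x => // k IHk x ltk.
  have [<-|/descend[z exz ltz]] := eqVneq x y; first by exists [::].
  have [|p [ep lp le_p]] := IHk z; first exact: leq_trans ltz ltk.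
  by exists (z :: p); rewrite /= exz; split=> //; apply: leq_ltn_trans ltz.
split=> x y; have [p [ep lp le_p]] := upper x y.
  by apply/connectP; exists p.
rewrite (gdist_geodesic ep lp) => [|q eq lq].
  by apply/eqP; rewrite eqn_leq le_p -lp lower.
by apply: leq_trans le_p _; rewrite -lq lower.
Qed.

Hypotheses (e_irr : irreflexive e) (e_conn : connected e).
Hypothesis phi_iso : forall x y, hamming (phi x) (phi y) = gdist e x y.

Let W := phi @: [set: T].
Let f : rel (m.-tuple bool) := fun u v => [&& u \in W, v \in W & hypercube m u v].

Let phi_edge x y : f (phi x) (phi y) = e x y.
Proof. by rewrite /f !imset_f //= /hypercube phi_iso gdist1. Qed.

(** The image of a geodesic is a walk both in the induced subgraph and in the
cube, and its length is the Hamming distance between its ends, which no walk in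
either graph can beat. *)
Lemma isometric_image :
  exists (W' : {set m.-tuple bool}) (f' : rel (m.-tuple bool)),
    isometric_subgraph (hypercube m) W' f' /\ isomorphic_to e W' f'.
Proof.
exists W, f; have f_sub : subrel f (hypercube m) by move=> u v /and3P[].
split; last first.
  exists phi; split=> // x y eq_phi; apply/eqP.
  have [p [_ lp sp]] := gdist_walk (e_conn x y).
  move: sp; rewrite -phi_iso eq_phi (eqP (_ : hamming _ _ == 0)) ?hamming0 //.
  by case: p lp => //= ->.
split=> // [u v | _ _ /imsetP[x _ ->] /imsetP[y _ ->]].
  by rewrite /f /hypercube hammingC andbCA.
have [p [ep lp sp]] := gdist_walk (e_conn x y).
have fp : path f (phi x) (map phi p).
  by rewrite path_map; apply: sub_path ep => a b; rewrite /= phi_edge.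
have lphi : last (phi x) (map phi p) = phi y by rewrite last_map lp.
have geodesic q : path (hypercube m) (phi x) q -> last (phi x) q = phi y ->
    size (map phi p) <= size q.
  by rewrite size_map sp -phi_iso => hq <-; apply: hamming_walk.
split; first by apply/connectP; exists (map phi p).
rewrite (gdist_geodesic (sub_path f_sub fp) lphi geodesic).
by apply: gdist_geodesic fp lphi _ => q /(sub_path f_sub); apply: geodesic.
Qed.

End Embedding.

(** The coordinates of a cube may be indexed by any set with as many elements
as its dimension. *)
Lemma hamming_coordinates (T I : finType) (A : {set I}) (c : T -> pred I) m :
    #|A| = m ->
  exists phi : T -> m.-tuple bool, forall x y,
    hamming (phi x) (phi y) = #|[set i in A | c x i != c y i]|.
Proof.
move=> <-; exists (fun x => [tuple c x (enum_val k) | k < #|A|]) => x y.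
rewrite /hamming -(card_imset _ enum_val_inj); apply: eq_card => i.
rewrite inE; apply/imsetP/andP => [[k + ->] | [Ai cxy]].
  by rewrite inE !tnth_mktuple enum_valP.
exists (enum_rank_in Ai i); last by rewrite enum_rankK_in.
by rewrite inE !tnth_mktuple enum_rankK_in.
Qed.

(** * Inversion tables *)

Definition ordered_pairs n : {set 'I_n * 'I_n} :=
  [set p : 'I_n * 'I_n | p.1 < p.2].

Lemma card_ordered_pairs n : #|ordered_pairs n| = 'C(n, 2).
Proof.
have ->: #|ordered_pairs n| = \sum_(p : 'I_n * 'I_n | p.1 < p.2) 1.
  by rewrite -sum1_card; apply: eq_bigl => p; rewrite inE.
rewrite -bin2_sum big_mkord.
rewrite -(pair_big_dep xpredT (fun a b : 'I_n => a < b) (fun _ _ => 1)) /=.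
rewrite (exchange_big_dep xpredT) //=; apply: eq_bigr => b _.
by rewrite -(big_ord_widen n (fun=> 1)) 1?ltnW // sum1_card card_ord.
Qed.

Definition inverted n (u : 'S_n) (p : 'I_n * 'I_n) := u p.2 < u p.1.

Lemma ltn_tperm_succ n (i j x y : 'I_n) : val j = (val i).+1 -> x != y ->
  (tperm i j x < tperm i j y) =
  (x < y) (+) ((x == i) && (y == j) || (x == j) && (y == i)).
Proof.
move=> ji; case: tpermP => [->|->|/eqP xi /eqP xj];
  case: tpermP => [->|->|/eqP yi /eqP yj];
  do ?[move: xi xj]; do ?[move: yi yj]; rewrite -!val_eqE /= in ji *; lia.
Qed.

(** The witness [q] consists of the positions at which [u] takes the values [i]
and [j], put in increasing order.  The last clause is free of that order: if [u]
meets [i] first then [u] is not inverted at [q], and otherwise it is, so in both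
cases [u] and [v] disagree at [q] exactly when [v] reverses [i] and [j] as placed
by [u]. *)
Lemma inverted_swap n (u : 'S_n) (i j : 'I_n) : val j = (val i).+1 ->
  exists2 q, q \in ordered_pairs n &
    {in ordered_pairs n, forall p,
       inverted (u * tperm i j)%g p = inverted u p (+) (p == q)} /\
    forall v : 'S_n, (inverted u q != inverted v q)
                     = (v (u^-1 j) < v (u^-1 i))%g.
Proof.
move=> /= ji; pose a := (u^-1 i)%g; pose b := (u^-1 j)%g.
have ua : u a = i by rewrite permKV.
have ub : u b = j by rewrite permKV.
have neq_ab : a != b :> nat.
  by rewrite (inj_eq val_inj) (inj_eq perm_inj) -val_eqE /= ji ltn_eqF.
have swap p : p \in ordered_pairs n -> inverted (u * tperm i j)%g p =
    inverted u p (+) ((p == (a, b)) || (p == (b, a))).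
  case: p => x y; rewrite inE /inverted !permM /= => xy.
  have neq_u : u y != u x by rewrite (inj_eq perm_inj) -val_eqE neq_ltn xy orbT.
  rewrite ltn_tperm_succ //.
  by rewrite -ua -ub !(inj_eq perm_inj) !xpair_eqE orbC andbC [X in _ || X]andbC.
have neqv (v : 'S_n) : v a != v b :> nat.
  by rewrite (inj_eq val_inj) (inj_eq perm_inj).
have [ltab|leba] := ltnP a b.
  exists (a, b); first by rewrite inE.
  split=> [[x y] pP | v]; rewrite ?swap // -/a -/b /inverted /=.
    by move: pP; rewrite inE !xpair_eqE -!val_eqE /=; lia.
  by rewrite ua ub; lia.
exists (b, a); first by rewrite inE /=; lia.
split=> [[x y] pP | v]; rewrite ?swap // -/a -/b /inverted /=.
  by move: pP; rewrite inE !xpair_eqE -!val_eqE /=; lia.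
by move: (neqv v); rewrite ua ub; lia.
Qed.

(** Increasing values satisfy [i <= s i] for all [i]; since [s] permutes its
arguments both sides have the same sum, so equality holds throughout. *)
Lemma increasing_perm_id n (s : 'S_n) :
  (forall i j : 'I_n, val j = (val i).+1 -> s i < s j) -> s = 1%g.
Proof.
move=> s_incr.
have le_s k (i : 'I_n) : val i = k -> i <= s i.
  elim: k i => [|k IHk] i ik; first by rewrite [X in X <= _]ik.
  have ltk : k < n by have := ltn_ord i; rewrite [X in X < _]ik; lia.
  have := s_incr (Ordinal ltk) i ik; have := IHk (Ordinal ltk) erefl.
  by rewrite /= [X in _ -> _ -> X <= _]ik; lia.
have [_] := leqif_sum (fun (i : 'I_n) (_ : xpredT i) =>
                         leqif_eq (le_s _ i erefl)).
rewrite -(reindex_inj (@perm_inj _ s) (P := xpredT) (F := val)) eqxx.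
move/esym/forallP => fix_s; apply/permP => i.
by rewrite perm1; apply/val_inj/esym/eqP/fix_s.
Qed.

Lemma exists_descent n (u v : 'S_n) : u != v ->
  exists i j : 'I_n, val j = (val i).+1 /\ (v (u^-1 j) < v (u^-1 i))%g.
Proof.
move=> neq_uv.
have [/existsP[i /existsP[j /andP[/eqP ji lt]]] | none] := boolP
  [exists i : 'I_n, exists j : 'I_n,
     (val j == (val i).+1) && (v (u^-1 j) < v (u^-1 i))%g].
  by exists i, j.
case/eqP: neq_uv; apply/eqP; rewrite eq_mulVg1; apply/eqP.
apply: increasing_perm_id => i j ji; rewrite !permM ltn_neqAle; apply/andP; split.
  by rewrite (inj_eq val_inj) !(inj_eq perm_inj) -val_eqE ji ltn_eqF.
rewrite leqNgt; apply: contra none => lt.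
by apply/existsP; exists i; apply/existsP; exists j; rewrite ji eqxx.
Qed.

(** * The Bubble Sort graph *)

Lemma BSG_irr n : irreflexive (BSG n).
Proof.
move=> u; apply/existsP => -[s /andP[sS]].
by rewrite eq_mulVg1 mulKg => /eqP s1; rewrite s1 adjacent_transpositions_id in sS.
Qed.

Lemma BSG_P n (u w : 'S_n) :
  reflect (exists i j : 'I_n, val j = (val i).+1 /\ w = (u * tperm i j)%g)
          (BSG n u w).
Proof.
apply: (iffP existsP) => [[s /andP[/adjacent_transpositionsP[i [j [ji ->]]]]]|].
  by move=> /eqP ->; exists i, j.
move=> [i [j [ji ->]]]; exists (tperm i j); rewrite eqxx andbT.
by apply/adjacent_transpositionsP; exists i, j.
Qed.

Theorem proposition4 (n : nat) (hn : 2 <= n) :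
  cube_embeddable (BSG n) 'C(n, 2) /\
  (exists (W : {set 'C(n, 2).-tuple bool}) (f : rel ('C(n, 2).-tuple bool)),
     isometric_subgraph (hypercube 'C(n, 2)) W f /\
     isomorphic_to (BSG n) W f).
Proof.
have [phi phiE] :=
  hamming_coordinates (@inverted n) (card_ordered_pairs n).
have [conn iso] : connected (BSG n) /\
    forall u v, hamming (phi u) (phi v) = gdist (BSG n) u v.
  apply: cube_embedding_by_descent => [u _ /BSG_P[i [j [ji ->]]] | u v neq_uv].
    have [q qP [swap _]] := inverted_swap u ji.
    rewrite /hypercube phiE; apply/cards1P; exists q; apply/setP => p.
    rewrite in_set1 inE; case: (boolP (p \in _)) => [/swap-> | pNP] /=.
      by case: (inverted u p) (p == q) => [] [].
    by apply/esym/eqP => pq; rewrite pq qP in pNP.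
  have [i [j [ji desc]]] := exists_descent neq_uv.
  exists (u * tperm i j)%g; first by apply/BSG_P; exists i, j.
  have [q qP [swap agree]] := inverted_swap u ji.
  move: desc; rewrite -agree => diff_q.
  (* The swap repairs the disagreement at [q] and creates none. *)
  rewrite !phiE; apply: proper_card; apply/properP; split.
    apply/subsetP => p; rewrite !inE => /andP[pP]; rewrite pP swap ?inE //=.
    by have [-> | _] := eqVneq p q; rewrite ?addbF.
  exists q; first by rewrite inE qP.
  rewrite inE qP swap // eqxx /=.
  by case: (inverted u q) (inverted v q) diff_q => [] [].
split; first by split; last by exists phi.
exact: isometric_image (@BSG_irr n) conn iso.
Qed.
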